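(* Fix the ML-SANOS data (expiries $0=\hat T_0<\hat T_1<\cdots<\hat T_M$, normalized strikes $z^1<\cdots<0<\cdots<z^N$ containing $0$, volatility bounds $\sigma_{\max}>\sigma_{\min}>0$, $\Sigma_{\max}>\Sigma_{\min}>0$, smoothing parameter $\mu\in[0,1)$, and a feed-forward network $NQ_\theta:\mathbb{R}^{n_h}\to\mathbb{R}^{M}\times\mathbb{R}^{M\times N}$), and let $h\mapsto C(h;\cdot,\cdot)$ be the resulting ML-SANOS decoder defined in the context. Let $(s_t,h_t)_{t}$ be any sequence of random variables, indexed by discrete time steps $t$, with values in $\mathbb{R}\times\mathbb{R}^{n_h}$, such that $S_t:=\exp(s_t)$ is integrable for every $t$. For each $t$ put $C_t(T,K):=C(h_t;T,K)$ for $T\ge 0$, $K\ge 0$. Then for every time step $t$ and every realization, $S_t>0$ is a well-defined spot price and $C_t:\mathbb{R}_{\ge0}^2\to\mathbb{R}_{\ge0}$ is a well-defined call price surface (normalized to spot $1$) which is free of static arbitrage; and if $\mu>0$, it is smooth, i.e. for every $T>0$ the function $K\mapsto C_t(T,K)$ is infinitely differentiable on $(0,\infty)$.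
   Context: **Free of static arbitrage.** A call price surface is a function $C:\mathbb{R}_{\ge0}^2\to\mathbb{R}_{\ge0}$, $(T,K)\mapsto C(T,K)$ ($T$ = time to expiry, $K$ = strike relative to spot). It is free of static arbitrage iff it has no negative butterflies ($K\mapsto C(T,K)$ is convex for each $T$), no negative calendar spreads ($T\mapsto C(T,K)$ is non-decreasing for each $K$), and it satisfies for all $T,K\ge 0$: $C(T,0)=1$, $C(0,K)=(1-K)^+$, $\lim_{K\uparrow\infty}C(T,K)=0$, and $\partial_KC(T,0)\in[-1,0)$ (one-sided derivative at $K=0$). **Black–Scholes function.** For $S,K,W>0$: $\mathrm{BSCall}(S,K,W)=S\,\mathcal N(d_+)-K\,\mathcal N(d_-)$, with $d_\pm=\frac{\log(S/K)}{W}\pm\frac12W$ and $\mathcal N$ the standard normal distribution function; $\mathrm{BSCall}(S,K,0)=(S-K)^+$ and $\mathrm{BSCall}(S,0,W)=S$. **ML-SANOS decoder $h\mapsto C(h;\cdot,\cdot)$.** Here $NQ_\theta$ is any fixed feed-forward neural network map with continuous activations. Let $\mathrm{sigmoid}(y)=1/(1+e^{-y})$. 1. Set $(x^\sigma,x^\Sigma):=NQ_\theta(h)\in\mathbb{R}^{M}\times\mathbb{R}^{M\times N}$. 2. For $j=1,\dots,M$ and $i=1,\dots,N$ set $\sigma_j:=\sigma_{\min}\sqrt{\hat T_j}+\mathrm{sigmoid}(x^\sigma_j)(\sigma_{\max}-\sigma_{\min})$, $W_j:=\sum_{\ell=1}^j\sigma_\ell\big(\sqrt{\hat T_\ell}-\sqrt{\hat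 T_{\ell-1}}\big)$, $W_0:=0$, and $\Sigma_j^i:=\Sigma_{\min}+\mathrm{sigmoid}(x^\Sigma_{j,i})(\Sigma_{\max}-\Sigma_{\min})$. 3. Strikes: for $j\ge1$, $\hat K_j^i:=\exp(z^iW_j)$ for $i=1,\dots,N$, $\hat K_j^0:=\frac12\hat K_j^1$, $\hat K_j^{N+1}:=\frac32\hat K_j^N$. For $j=0$ there is the single strike $\hat K_0=(1)$ with weight $q_0=(1)$. 4. Weights: recursively for $j=1,\dots,M$, define $q_j=(q_j^0,\dots,q_j^{N+1})$ as follows. - Let $c^i_{j|j-1}:=\sum_\ell q_{j-1}^\ell(\hat K_{j-1}^\ell-\hat K_j^i)^+$ for $i=0,\dots,N+1$. With the conventions $\hat K_j^{-1}:=0$, $c_{j|j-1}^{-1}:=1$, let $dC^i:=\dfrac{c^i_{j|j-1}-c^{i-1}_{j|j-1}}{\hat K_j^i-\hat K_j^{i-1}}$ for $i=0,\dots,N+1$ and $dC^{N+2}:=0$. Set $q_{j|j-1}^i:=dC^{i+1}-dC^i$ for $i=0,\dots,N+1$. - For $i=1,\dots,N$ let $\xi_j^{i\pm}:=\pm\dfrac{(\hat K_j^i)^2}{(\hat K_j^{i+1}-\hat K_j^{i-1})(\hat K_j^{i\pm1}-\hat K_j^i)}\,\Sigma_j^i\,(\hat T_j-\hat T_{j-1})\ge0$, and $\xi_j^{0\pm}=\xi_j^{(N+1)\pm}:=0$. - Let $\Xi_j$ be the tridiagonal $(N+2)\times(N+2)$ matrix (indices $0,\dots,N+1$) with diagonal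 entries $(\Xi_j)_{i,i}=1+\xi_j^{i+}+\xi_j^{i-}$, upper-diagonal entries $(\Xi_j)_{i,i+1}=-\xi_j^{(i+1)-}$, and lower-diagonal entries $(\Xi_j)_{i,i-1}=-\xi_j^{(i-1)+}$. Set $q_j:=\Xi_j^{-1}q_{j|j-1}$ (column vectors). 5. Call prices: for $T\in(\hat T_{j-1},\hat T_j]$ let $\alpha_j(T):=\frac{T-\hat T_{j-1}}{\hat T_j-\hat T_{j-1}}$, $W(T):=\alpha_j(T)W_j+(1-\alpha_j(T))W_{j-1}$, and $$C(h;T,K):=\alpha_j(T)\sum_i q_j^i\,\mathrm{BSCall}\big(\hat K_j^i,K,\mu W(T)\big)+(1-\alpha_j(T))\sum_i q_{j-1}^i\,\mathrm{BSCall}\big(\hat K_{j-1}^i,K,\mu W(T)\big).$$ For $T>\hat T_M$: $C(h;T,K):=\sum_iq_M^i\,\mathrm{BSCall}(\hat K_M^i,K,\mu W(T))$ with $W(T):=W_M\sqrt{T/\hat T_M}$. For $T=0$: $C(h;0,K):=(1-K)^+$. *)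

(* Defs.v *)
From HB Require Import structures.
From mathcomp Require Import all_boot all_order all_algebra.
From mathcomp Require Import all_classical all_reals all_analysis.

Set Implicit Arguments.
Unset Strict Implicit.
Unset Printing Implicit Defensive.

Import Order.TTheory GRing.Theory Num.Theory.
Import numFieldNormedType.Exports.

Local Open Scope classical_set_scope.
Local Open Scope ring_scope.

(* Surfaces are total functions R -> R -> R, [C T K]; only the quadrant
   T, K >= 0 is meaningful, and every predicate below is restricted to it. *)

Definition pospart (R : realType) (x : R) : R := Num.max x 0.

Definition call_price_surface (R : realType) (C : R -> R -> R) : Prop :=
  forall T K, 0 <= T -> 0 <= K -> 0 <= C T K.

Definition no_negative_butterflies (R : realType) (C : R -> R -> R) : Prop :=
  forall T, 0 <= T -> convex_function (`[0, +oo[%classic : set R) (C T).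

Definition no_negative_calendar_spreads (R : realType) (C : R -> R -> R) :
    Prop :=
  forall K, 0 <= K -> forall T1 T2, 0 <= T1 -> T1 <= T2 -> C T1 K <= C T2 K.

Definition right_derivative (R : realType) (f : R -> R) (x l : R) : Prop :=
  h^-1 * (f (x + h) - f x) @[h --> 0^'+] --> l.

Record free_of_static_arbitrage (R : realType) (C : R -> R -> R) : Prop := {
  fsa_butterfly : no_negative_butterflies C;
  fsa_calendar : no_negative_calendar_spreads C;
  fsa_strike0 : forall T, 0 <= T -> C T 0 = 1;
  fsa_expiry0 : forall K, 0 <= K -> C 0 K = pospart (1 - K);
  fsa_strike_pinfty : forall T, 0 <= T -> C T K @[K --> +oo] --> (0 : R);
  fsa_slope0 : forall T, 0 <= T ->
    exists2 l : R, right_derivative (C T) 0 l & -1 <= l < 0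
}.

Definition smooth_in_strike (R : realType) (C : R -> R -> R) : Prop :=
  forall T, 0 < T ->
  forall (n : nat) (K : R), 0 < K -> derivable (derive1n n (C T)) K 1.

Definition normal_cdf (R : realType) (x : R) : R :=
  fine (normal_prob 0 1 `]-oo, x]).

Definition bs_call (R : realType) (S K W : R) : R :=
  if K == 0 then S
  else if W == 0 then pospart (S - K)
  else S * normal_cdf (ln (S / K) / W + W / 2)
       - K * normal_cdf (ln (S / K) / W - W / 2).

(* Each neuron has its own scalar activation, so that linear output neurons,
   skip connections and mixed layers are all covered. *)
Record layer (R : realType) (n m : nat) := Layer {
  weights : 'M[R]_(n, m);
  bias : 'rV[R]_m;
  activation : 'I_m -> R -> R;
  activation_continuous : forall i, continuous (activation i)
}.

Definition layer_eval (R : realType) n m (L : layer R n m) (x : 'rV[R]_n) :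
    'rV[R]_m :=
  \row_i activation L i ((x *m weights L + bias L) 0 i).

Inductive network (R : realType) : nat -> nat -> Type :=
| OutputLayer n m of layer R n m : network R n m
| HiddenLayer n k m of layer R n k & network R k m : network R n m.

Fixpoint network_eval (R : realType) n m (nn : network R n m) :
    'rV[R]_n -> 'rV[R]_m :=
  match nn with
  | OutputLayer _ _ L => layer_eval L
  | HiddenLayer _ _ _ L nn' => fun x => network_eval nn' (layer_eval L x)
  end.

Definition sigmoid (R : realType) (y : R) : R := 1 / (1 + expR (- y)).

(* Entry (j, i) of a matrix with rows and columns numbered from 1. *)
Definition entry1 (R : realType) m n (A : 'M[R]_(m, n)) (j i : nat) : R :=
  match (insub j.-1 : option 'I_m), (insub i.-1 : option 'I_n) with
  | Some j', Some i' => A j' i'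
  | _, _ => 0
  end.

(* Expiries and normalized strikes keep their usual numbering: only
   [expiry 0], ..., [expiry M] and [zstrike 1], ..., [zstrike N] are used.
   The first M outputs of the network are x^sigma, and the other M * N are
   the entries of x^Sigma. *)
Record sanos_data (R : realType) (nh M N : nat) := SanosData {
  expiry : nat -> R;
  zstrike : nat -> R;
  sigma_min : R;
  sigma_max : R;
  Sigma_min : R;
  Sigma_max : R;
  mu : R;
  NQ : network R nh (M + M * N);
  expiries_pos : (0 < M)%N;
  expiry0 : expiry 0 = 0;
  expiry_incr : forall j, (j < M)%N -> expiry j < expiry j.+1;
  zstrike_incr : forall i, (1 <= i < N)%N -> zstrike i < zstrike i.+1;
  zstrike_has0 : exists2 i, (1 <= i <= N)%N & zstrike i = 0;
  sigma_bounds : 0 < sigma_min < sigma_max;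
  Sigma_bounds : 0 < Sigma_min < Sigma_max;
  mu_bounds : 0 <= mu < 1
}.

Section Decoder.
Context {R : realType} {nh M N : nat} (D : sanos_data R nh M N).
Variable h : 'rV[R]_nh.

Local Notation That := (expiry D).

Definition x_sigma : 'rV[R]_M := lsubmx (network_eval (NQ D) h).
Definition x_Sigma : 'M[R]_(M, N) := vec_mx (rsubmx (network_eval (NQ D) h)).

Definition sigma (j : nat) : R :=
  sigma_min D * Num.sqrt (That j)
  + sigmoid (entry1 x_sigma 1 j) * (sigma_max D - sigma_min D).

Definition vol (j : nat) : R :=
  \sum_(1 <= l < j.+1) sigma l * (Num.sqrt (That l) - Num.sqrt (That l.-1)).

Definition Sigma (j i : nat) : R :=
  Sigma_min D + sigmoid (entry1 x_Sigma j i) * (Sigma_max D - Sigma_min D).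

(* The marginal at expiry j has [natoms j] atoms, numbered from 0. *)
Definition natoms (j : nat) : nat := if j is 0 then 1 else N.+2.

Definition strike (j i : nat) : R :=
  if j == 0%N then 1
  else if i == 0%N then 1 / 2 * expR (zstrike D 1 * vol j)
  else if i == N.+1 then 3 / 2 * expR (zstrike D N * vol j)
  else expR (zstrike D i * vol j).

Definition xi_plus (j i : nat) : R :=
  if (1 <= i <= N)%N then
    strike j i ^+ 2
      / ((strike j i.+1 - strike j i.-1) * (strike j i.+1 - strike j i))
    * Sigma j i * (That j - That j.-1)
  else 0.

Definition xi_minus (j i : nat) : R :=
  if (1 <= i <= N)%N then
    - (strike j i ^+ 2
      / ((strike j i.+1 - strike j i.-1) * (strike j i.-1 - strike j i)))
    * Sigma j i * (That j - That j.-1)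
  else 0.

Definition Xi (j : nat) : 'M[R]_N.+2 :=
  \matrix_(i, k)
    if k == i :> nat then 1 + xi_plus j i + xi_minus j i
    else if k == i.+1 :> nat then - xi_minus j i.+1
    else if k.+1 == i :> nat then - xi_plus j i.-1
    else 0.

(* dC^i, given the prices c^0, ..., c^(N+1) at the strikes of expiry j; the
   price at the conventional strike K^(-1) = 0 is 1. *)
Definition call_slope (j : nat) (c : nat -> R) (i : nat) : R :=
  if i == 0%N then (c 0%N - 1) / (strike j 0 - 0)
  else if i == N.+2 then 0
  else (c i - c i.-1) / (strike j i - strike j i.-1).

(* [strike_prices j q i] is c^i_(j+1|j), where q are the weights of expiry j. *)
Definition strike_prices (j : nat) (q : 'cV[R]_(natoms j)) (i : nat) : R :=
  \sum_(l < natoms j) q l 0 * pospart (strike j l - strike j.+1 i).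

Fixpoint weight (j : nat) : 'cV[R]_(natoms j) :=
  match j return 'cV[R]_(natoms j) with
  | 0 => const_mx 1
  | j'.+1 =>
      let dC := call_slope j'.+1 (strike_prices (weight j')) in
      invmx (Xi j'.+1) *m (\col_(i < N.+2) (dC i.+1 - dC i))
  end.

(* For 0 < T <= That M, the j such that That (j - 1) < T <= That j. *)
Definition segment (T : R) : nat :=
  find (fun j => T <= That j) (iota 0 M.+1).

Definition alpha (T : R) : R :=
  let j := segment T in (T - That j.-1) / (That j - That j.-1).

Definition vol_at (T : R) : R :=
  if That M < T then vol M * Num.sqrt (T / That M)
  else let j := segment T in
    alpha T * vol j + (1 - alpha T) * vol j.-1.

Definition marginal_call (j : nat) (K V : R) : R :=
  \sum_(i < natoms j) weight j i 0 * bs_call (strike j i) K V.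

Definition decoder (T K : R) : R :=
  if T == 0 then pospart (1 - K)
  else if That M < T then marginal_call M K (mu D * vol_at T)
  else let j := segment T in
    alpha T * marginal_call j K (mu D * vol_at T)
    + (1 - alpha T) * marginal_call j.-1 K (mu D * vol_at T).

(* Division, [invmx] and [bs_call] are total; this says that the construction
   only ever uses them where they have their usual meaning. *)
Definition decoder_well_defined : Prop :=
  (forall j, (1 <= j <= M)%N ->
    [/\ 0 < strike j 0,
        forall i, (i <= N)%N -> strike j i < strike j i.+1
      & Xi j \in unitmx])
  /\ (forall T, 0 < T -> 0 <= mu D * vol_at T).

End Decoder.

Definition row_of_tuple (R : realType) n (t : n.-tuple R) : 'rV[R]_n :=
  \row_i tnth t i.

(* Main.v *)
Require Import Defs.
From HB Require Import structures.
From mathcomp Require Import all_boot all_order all_algebra.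
From mathcomp Require Import all_classical all_reals all_analysis.
From mathcomp Require Import ring lra.

(** The Black-Scholes price is a supremum of functions linear in spot and
    strike: [BSCall(S, K, V) = sup_x (S N(x + V) - K N(x))], attained at
    [x = d_-].  Hence it is convex in [S], convex in [K], nondecreasing in [V]
    and nonnegative, and its behaviour at [K = 0] and [K = +oo] follows by
    comparing with a fixed [x].

    The weights [q_(j|j-1)] split every atom of the marginal [j - 1] between its
    two neighbouring strikes of expiry [j], keeping its mean.  The columns of
    [Xi_j] sum to 1, its off-diagonal entries are nonpositive, and it maps the
    strikes to themselves, so [Xi_j^-1] is nonnegative and is again a
    mean-preserving spread.  The marginals therefore increase in convex order,
    which together with the monotonicity in [V] gives the absence of calendar
    arbitrage; for each expiry the surface is a finite mixture of Black-Scholes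
    prices with total weight 1 and mean spot 1, which gives the rest. *)

Set Implicit Arguments.
Unset Strict Implicit.
Unset Printing Implicit Defensive.

Import Order.TTheory GRing.Theory Num.Theory.
Import numFieldNormedType.Exports.

Local Open Scope classical_set_scope.
Local Open Scope ring_scope.

(** * The normal distribution function *)

Section NormalCdf.
Context {R : realType}.
Local Notation N := (@normal_cdf R).
Local Notation phi := (@normal_pdf R 0 1).

Lemma normal_pdf_gt0 (x : R) : 0 < phi x.
Proof.
by rewrite /normal_pdf oner_eq0 mulr_gt0 ?expR_gt0// normal_peak_gt0 ?oner_eq0.
Qed.

(** The Gaussian density ratio: it makes the derivative of [S * N (x + V) - K * N x] a multiple of
    [phi x]. *)
Lemma normal_pdf_shift (x V : R) : phi (x + V) = expR (- x * V - V ^+ 2 / 2) * phi x.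
Proof.
rewrite /normal_pdf oner_eq0 /normal_fun mulrCA -expRD; congr (_ * expR _).
by rewrite !subr0 expr1n; field.
Qed.

Lemma is_derive_normal_cdf (x : R) : is_derive x 1 N (phi x).
Proof.
have [] := @continuous_FTC1 R phi -oo%O x (x + 1) _ _ _ _.
- by rewrite ltrDl.
- by apply: integrableS (integrable_normal_pdf 0 1) => //; exact: measurable_itv.
- by rewrite ltNyr.
- by apply: continuous_normal_pdf; rewrite oner_eq0.
rewrite -[X in derivable X]/N -[X in derive1 X]/N => dN NE.
by split; [exact: dN | rewrite -derive1E; exact: NE].
Qed.

Lemma normal_cdf_ge0 (x : R) : 0 <= N x.
Proof. exact/fine_ge0/measure_ge0. Qed.

Lemma normal_cdf_le1 (x : R) : N x <= 1.
Proof.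
rewrite -lee_fin /normal_cdf fineK ?fin_num_measure//; exact: probability_le1.
Qed.

Lemma normal_cdf_nondecreasing : {homo N : x y / x <= y}.
Proof.
move=> x y xy; apply: fine_le; rewrite ?fin_num_measure//.
by apply: le_measure; rewrite ?inE//; exact: subitvPr.
Qed.

(** The identity, as a random variable under the normal law, has distribution function [N], so the
    general limits of distribution functions apply. *)
Let id_R : measurableTypeR R -> R := idfun.

HB.instance Definition _ :=
  @isMeasurableFun.Build _ _ _ _ id_R (@measurable_id _ _ setT).

Lemma cvg_normal_cdfNy : N x @[x --> -oo] --> (0 : R).
Proof. by have /fine_cvg := cvg_cdfNy0 (id_R : {RV (@normal_prob R 0 1) >-> R}). Qed.

Lemma cvg_normal_cdfy : N x @[x --> +oo] --> (1 : R).
Proof. by have /fine_cvg := cvg_cdfy1 (id_R : {RV (@normal_prob R 0 1) >-> R}). Qed.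

End NormalCdf.

(** * Iterated differentiability on a set *)

Section Smoothness.
Context {R : realType}.
Implicit Types (A : set R) (f g u : R -> R) (n : nat).

(** Each derivative is a witness constrained only on [A], so the closure rules go by induction on
    [n] without computing iterated derivatives; [diff_n_derivable] returns to [derive1n]. *)
Fixpoint diff_n A n f : Prop :=
  if n is n'.+1 then
    exists2 g, (forall x, A x -> is_derive x 1 f (g x)) & diff_n A n' g
  else True.

Lemma diff_nS A n f : diff_n A n.+1 f -> diff_n A n f.
Proof.
by elim: n f => [//|n IH] f [g fg /IH gn]; exists g.
Qed.

Lemma diff_n_cst A n (c : R) : diff_n A n (cst c).
Proof.
elim: n c => [//|n IH] c; exists (cst 0); last exact: IH.
by move=> x _; exact: is_derive_cst.
Qed.

Lemma diff_n_id A n : diff_n A n id.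
Proof.
case: n => [//|n]; exists (cst 1); last exact: diff_n_cst.
by move=> x _; exact: is_derive_id.
Qed.

Lemma diff_nD A n f g : diff_n A n f -> diff_n A n g -> diff_n A n (f \+ g).
Proof.
elim: n f g => [//|n IH] f g [f' ff' f'n] [g' gg' g'n].
exists (f' \+ g'); last exact: IH.
by move=> x Ax; apply: is_deriveD; [exact: ff' | exact: gg'].
Qed.

Lemma diff_nM A n f g : diff_n A n f -> diff_n A n g -> diff_n A n (f \* g).
Proof.
elim: n f g => [//|n IH] f g fn gn.
(* The product rule pairs each derivative with the other function itself, which is therefore also
   needed at the lower order. *)
have := (diff_nS fn, diff_nS gn).
case: fn gn => f' ff' f'n [g' gg' g'n] [fn gn].
exists ((f \* g') \+ (g \* f')).
  by move=> x Ax; apply: is_deriveM; [exact: ff' | exact: gg'].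
by apply: diff_nD; exact: IH.
Qed.

Lemma diff_nN A n f : diff_n A n f -> diff_n A n (\- f).
Proof.
move=> fn; have -> : \- f = cst (-1) \* f.
  by apply/funext => x /=; rewrite mulN1r.
by apply: diff_nM => //; exact: diff_n_cst.
Qed.

Lemma diff_n_comp A (B : set R) n f u : (forall x, A x -> B (u x)) ->
  diff_n B n f -> diff_n A n u -> diff_n A n (f \o u).
Proof.
move=> AB; elim: n f u AB => [//|n IH] f u AB fn un.
have := diff_nS un; case: fn un => f' ff' f'n [u' uu' u'n] un.
exists ((f' \o u) \* u').
  move=> x Ax; apply: is_derive1_comp; [exact/ff'/AB | exact: uu'].
by apply: diff_nM => //; exact: IH.
Qed.

Lemma diff_n_sum A n (I : Type) (r : seq I) (F : I -> R -> R) :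
  (forall i, diff_n A n (F i)) -> diff_n A n (fun x => \sum_(i <- r) F i x).
Proof.
move=> Fn; elim: r => [|i r IH].
  have -> : (fun x => \sum_(i <- [::]) F i x) = cst 0.
    by apply/funext => x; rewrite big_nil.
  exact: diff_n_cst.
have -> : (fun x => \sum_(j <- i :: r) F j x) =
    F i \+ (fun x => \sum_(j <- r) F j x).
  by apply/funext => x; rewrite big_cons.
exact: diff_nD.
Qed.

(** Openness turns equality on [A] into equality near each of its points, so the witnesses for [f]
    serve for [g]. *)
Lemma diff_n_eq A n f g : open A -> (forall x, A x -> f x = g x) ->
  diff_n A n f -> diff_n A n g.
Proof.
case: n => [//|n] oA fg [f' ff' f'n]; exists f' => // x Ax.
apply: near_eq_is_derive (ff' x Ax).
by near=> y; apply: fg; near: y; exact: open_nbhs_nbhs.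
Unshelve. all: by end_near. Qed.

Lemma diff_n_inv n : diff_n [set x : R | 0 < x] n (fun x => x^-1).
Proof.
elim: n => [//|n IH]; exists (\- (GRing.inv \* GRing.inv)).
  move=> x /= x0; have xn0 : id x != 0 by rewrite gt_eqF.
  have := @is_deriveV R id x 1 1 xn0 (is_derive_id _ _).
  by rewrite /GRing.scale/= mulr1 expr2 invfM.
by apply/diff_nN/diff_nM.
Qed.

Lemma diff_n_ln n : diff_n [set x : R | 0 < x] n (@ln R).
Proof.
case: n => [//|n]; exists (fun x => x^-1); last exact: diff_n_inv.
by move=> x; exact: is_derive1_ln.
Qed.

Lemma diff_n_expR n : diff_n setT n (@expR R).
Proof.
by elim: n => [//|n IH]; exists expR => // x _; exact: is_derive_expR.
Qed.

Lemma diff_n_normal_cdf n : diff_n setT n (@normal_cdf R).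
Proof.
case: n => [//|n]; exists (normal_pdf 0 1).
  by move=> x _; exact: is_derive_normal_cdf.
have -> : @normal_pdf R 0 1 = cst (normal_peak 1) \*
    (expR \o ((cst (- 2^-1)) \* (id \* id))).
  apply/funext => x; rewrite /normal_pdf oner_eq0 /normal_fun/= subr0 expr1n.
  by congr (_ * expR _); field.
apply: diff_nM; first exact: diff_n_cst.
apply: (@diff_n_comp _ setT) => //; first exact: diff_n_expR.
apply: diff_nM; first exact: diff_n_cst.
by apply: diff_nM; exact: diff_n_id.
Qed.

Lemma diff_n_derivable A n f : open A -> diff_n A n.+1 f ->
  forall x, A x -> derivable (derive1n n f) x 1.
Proof.
move=> oA; elim: n f => [|n IH] f [g fg gn] x Ax; first by case: (fg x Ax).
rewrite derive1Sn; apply: (IH _ _ x Ax).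
apply: (@diff_n_eq A n.+1 g) => // y Ay.
by rewrite derive1E; case: (fg y Ay).
Qed.

End Smoothness.

(** * The Black-Scholes function *)

Section BlackScholes.
Context {R : realType}.
Local Notation N := (@normal_cdf R).
Local Notation phi := (@normal_pdf R 0 1).

Lemma bs_call_K0 (S V : R) : bs_call S 0 V = S.
Proof. by rewrite /bs_call eqxx. Qed.

Lemma bs_call_V0 (S K : R) : 0 < S -> 0 <= K -> bs_call S K 0 = pospart (S - K).
Proof.
move=> S0 K0; rewrite /bs_call eqxx; case: eqVneq => // ->.
by rewrite /pospart subr0 max_l// ltW.
Qed.

(** Since [d_+ = d_- + V], the price is the value at [x = d_-] of [S * N (x + V) - K * N x]. *)
Lemma bs_call_d (S K V : R) : K != 0 -> V != 0 ->
  bs_call S K V =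
  S * N (ln (S / K) / V - V / 2 + V) - K * N (ln (S / K) / V - V / 2).
Proof.
move=> K0 V0; rewrite /bs_call (negbTE K0) (negbTE V0).
by congr (_ * N _ - _); field.
Qed.

(* The derivative of [x |-> S N(x + V) - K N(x)] is
   [K phi(x) (exp (V (d_- - x)) - 1)], so [d_-] is the maximum. *)
Lemma bs_call_ub (S K V x : R) : 0 < S -> 0 <= K -> 0 <= V ->
  S * N (x + V) - K * N x <= bs_call S K V.
Proof.
move=> S0 K0' V0'; have [->|Kn0] := eqVneq K 0.
  by rewrite bs_call_K0 mul0r subr0 ler_piMr ?normal_cdf_le1 ?ltW.
have K0 : 0 < K by rewrite lt0r Kn0.
have [->|Vn0] := eqVneq V 0.
  rewrite bs_call_V0// addr0 -mulrBl /pospart.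
  have [N0 N1] := (normal_cdf_ge0 x, normal_cdf_le1 x).
  rewrite le_max; case: (leP 0 (S - K)) => SK; first by rewrite ler_piMr.
  by apply/orP; right; apply: mulr_le0_ge0 => //; exact: ltW.
have V0 : 0 < V by rewrite lt0r Vn0.
rewrite bs_call_d//; set y := _ - V / 2.
pose G (z : R) : R := S * N (z + V) - K * N z.
pose dG (z : R) : R := K * phi z * (expR (V * (y - z)) - 1).
have dGE (z : R) : is_derive z (1 : R) G (dG z).
  have dN1 : is_derive z (1 : R) (N \o (fun z => z + V)) (phi (z + V) * 1).
    by apply: is_derive1_comp; [exact: is_derive_normal_cdf | exact: is_derive_shift].
  have dN := is_derive_normal_cdf z.
  rewrite (_ : dG z = S * (phi (z + V) * 1) - K * phi z).
    by apply: is_deriveB; apply: is_deriveZ.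
  rewrite /dG mulr1 normal_pdf_shift.
  have -> : S = K * expR (ln (S / K)).
    by rewrite lnK ?posrE ?divr_gt0// mulrC divfK// gt_eqF.
  have -> : V * (y - z) = ln (S / K) + (- z * V - V ^+ 2 / 2).
    by rewrite /y; field; rewrite gt_eqF.
  by rewrite expRD; ring.
have cG a b : {within `[a, b], continuous G}.
  apply: derivable_within_continuous => z _; by case: (dGE z).
rewrite -/(G x) -/(G y) -subr_ge0.
(* Here [y] is [d_-]: [dG] is nonnegative to its left and nonpositive to its right, and the mean
   value theorem is used on either side. *)
have [xy|yx] := leP x y.
  have [c + ->] := MVT_segment xy (fun z _ => dGE z) (@cG _ _).
  rewrite in_itv/= => /andP[_ cy]; rewrite mulr_ge0 ?subr_ge0//.
  apply: mulr_ge0; first by rewrite mulr_ge0// ltW// normal_pdf_gt0.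
  by rewrite subr_ge0 -expR0 ler_expR mulr_ge0 ?subr_ge0.
have [c + E] := MVT_segment (ltW yx) (fun z _ => dGE z) (@cG _ _).
rewrite in_itv/= => /andP[yc _].
rewrite -opprB E oppr_ge0 mulr_le0_ge0 ?subr_ge0 ?(ltW yx)//.
apply: mulr_ge0_le0; first by rewrite mulr_ge0// ltW// normal_pdf_gt0.
by rewrite subr_le0 -expR0 ler_expR mulr_ge0_le0 ?subr_le0.
Qed.

(** As [x] goes to [-oo] and [+oo], [c * N x] tends to 0 and to [c]. This covers suprema that are
    only approached in the limit. *)
Lemma mul_normal_cdf_ub (c B : R) : (forall x, c * N x <= B) ->
  0 <= B /\ c <= B.
Proof.
move=> HB; split.
  have cv : c * N x @[x --> -oo] --> c * 0 by apply: cvgMr; exact: cvg_normal_cdfNy.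
  by rewrite -(mulr0 c); apply: (cvgr_to_le cv); exact: nearW.
have cv : c * N x @[x --> +oo] --> c * 1 by apply: cvgMr; exact: cvg_normal_cdfy.
by rewrite -(mulr1 c); apply: (cvgr_to_le cv); exact: nearW.
Qed.

(** For nonzero [K] and [V], the hypothesis at [x = d_-] is the claim; otherwise it is passed to the
    limit at infinity. With [bs_call_ub], comparisons of prices reduce to a fixed [x]. *)
Lemma bs_call_least (S K V B : R) : 0 < S -> 0 <= K -> 0 <= V ->
  (forall x, S * N (x + V) - K * N x <= B) -> bs_call S K V <= B.
Proof.
move=> S0 K0 V0 HB; have [K00|K00] := eqVneq K 0.
  rewrite K00 bs_call_K0; apply: (proj2 (mul_normal_cdf_ub _)) => x.
  by have := HB (x - V); rewrite K00 mul0r subr0 subrK.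
have [V00|V00] := eqVneq V 0; last by rewrite bs_call_d.
rewrite V00 bs_call_V0 // /pospart ge_max; apply/andP/and_comm.
apply: mul_normal_cdf_ub => x.
by have := HB x; rewrite V00 addr0 mulrBl.
Qed.

(** As [N (x + V) >= N x], the price dominates [(S - K) * N x] for every [x]. *)
Lemma bs_call_ge (S K V : R) : 0 < S -> 0 <= K -> 0 <= V ->
  0 <= bs_call S K V /\ S - K <= bs_call S K V.
Proof.
move=> S0 K0 V0; apply: mul_normal_cdf_ub => x.
apply: le_trans (bs_call_ub x S0 K0 V0).
by rewrite mulrBl lerB// ler_pM2l// normal_cdf_nondecreasing// lerDl.
Qed.

Lemma bs_call_vol_le (S K V1 V2 : R) : 0 < S -> 0 <= K -> 0 <= V1 -> V1 <= V2 ->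
  bs_call S K V1 <= bs_call S K V2.
Proof.
move=> S0 K0 V10 V12; apply: bs_call_least => // x.
apply: le_trans (bs_call_ub x S0 K0 (le_trans V10 V12)).
by rewrite lerB// ler_pM2l// normal_cdf_nondecreasing// lerD2l.
Qed.

Lemma bs_call_strike_convex (S V t K1 K2 : R) : 0 < S -> 0 <= V ->
  0 <= t <= 1 -> 0 <= K1 -> 0 <= K2 ->
  bs_call S (t * K1 + (1 - t) * K2) V
    <= t * bs_call S K1 V + (1 - t) * bs_call S K2 V.
Proof.
move=> S0 V0 /andP[t0 t1] K10 K20; have t1' : 0 <= 1 - t by rewrite subr_ge0.
apply: bs_call_least => //; first by rewrite addr_ge0 ?mulr_ge0.
move=> x; have := ler_wpM2l t0 (bs_call_ub x S0 K10 V0).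
have := ler_wpM2l t1' (bs_call_ub x S0 K20 V0).
by move: (N _) (N _) (bs_call _ _ _) (bs_call _ _ _) => *; lra.
Qed.

Lemma bs_call_spot_convex (K V a b c : R) : 0 <= K -> 0 <= V ->
  0 < a -> a <= b -> b <= c ->
  (c - a) * bs_call b K V
    <= (c - b) * bs_call a K V + (b - a) * bs_call c K V.
Proof.
move=> K0 V0 a0 ab bc; have b0 := lt_le_trans a0 ab; have c0 := lt_le_trans b0 bc.
(* If [a = c], the three points coincide and both sides vanish; otherwise one may divide by
   [c - a]. *)
have := le_trans ab bc; rewrite le_eqVlt => /predU1P[ac|ac].
  have E : a = b by apply/eqP; rewrite eq_le ab ac.
  by rewrite -ac -E subrr !mul0r addr0.
have ca : 0 < c - a by rewrite subr_gt0.
rewrite mulrC -ler_pdivlMr//; apply: bs_call_least => // x; rewrite ler_pdivlMr//.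
have cb0 : 0 <= c - b by rewrite subr_ge0.
have ba0 : 0 <= b - a by rewrite subr_ge0.
have := lerD (ler_wpM2l cb0 (bs_call_ub x a0 K0 V0))
             (ler_wpM2l ba0 (bs_call_ub x c0 K0 V0)).
by apply: le_trans; rewrite le_eqVlt; apply/orP; left; apply/eqP; ring.
Qed.

(** For [V > 0] the bound on [K] says [d_- >= y], and [S * N d_+] is at most [S]. *)
Lemma bs_call_le_small_strike (S K V y : R) : 0 < S -> 0 <= V -> 0 < K ->
  K <= S * expR (- V * (y + V / 2)) -> bs_call S K V <= S - K * N y.
Proof.
move=> S0 V0 K0 Kle.
have [V00|V00] := eqVneq V 0.
  move: Kle; rewrite V00 oppr0 mul0r expR0 mulr1 => KS.
  rewrite (bs_call_V0 S0 (ltW K0)) /pospart max_l ?subr_ge0//.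
  by rewrite lerB// ler_piMr ?normal_cdf_le1 ?ltW.
have Vgt : 0 < V by rewrite lt_neqAle eq_sym V00.
rewrite bs_call_d ?gt_eqF//; apply: lerB.
  by rewrite ler_piMr ?normal_cdf_le1 ?ltW.
rewrite ler_pM2l// normal_cdf_nondecreasing//.
rewrite lerBrDr ler_pdivlMr// -ler_expR lnK ?posrE ?divr_gt0//.
rewrite ler_pdivlMr// mulrC; have := ler_wpM2r (expR_ge0 ((y + V / 2) * V)) Kle.
by rewrite -mulrA -expRD [_ * V]mulrC mulNr addNr expR0 mulr1.
Qed.

(** For [V > 0] the bound on [K] says [d_+ <= y], and the term [K * N d_-] is dropped. *)
Lemma bs_call_le_large_strike (S K V y : R) : 0 < S -> 0 <= V -> 0 < K ->
  S * expR (- V * (y - V / 2)) <= K -> bs_call S K V <= S * N y.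
Proof.
move=> S0 V0 K0 Kle.
have [V00|V00] := eqVneq V 0.
  move: Kle; rewrite V00 oppr0 mul0r expR0 mulr1 => KS.
  rewrite (bs_call_V0 S0 (ltW K0)) /pospart max_r ?subr_le0//.
  by rewrite mulr_ge0 ?normal_cdf_ge0 ?ltW.
have Vgt : 0 < V by rewrite lt0r V00.
rewrite bs_call_d ?gt_eqF//; apply: (@le_trans _ _ (S * N (ln (S / K) / V - V / 2 + V))).
  by rewrite gerBl mulr_ge0 ?normal_cdf_ge0 ?ltW.
rewrite ler_pM2l// normal_cdf_nondecreasing//.
have -> : ln (S / K) / V - V / 2 + V = ln (S / K) / V + V / 2 by field.
rewrite -lerBrDr ler_pdivrMr// -ler_expR lnK ?posrE ?divr_gt0//.
rewrite ler_pdivrMr// mulrC.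
have := ler_wpM2r (expR_ge0 ((y - V / 2) * V)) Kle.
by rewrite -mulrA -expRD [_ * V]mulrC mulNr addNr expR0 mulr1.
Qed.

(** For small strikes the price lies between [S - K] and [S - K * N y], so the quotient lies between
    [-1] and [- N y], where [y] is arbitrarily large. *)
Lemma bs_call_slope0 (S V : R) : 0 < S -> 0 <= V ->
  right_derivative (fun K => bs_call S K V) 0 (-1).
Proof.
move=> S0 V0; rewrite /right_derivative bs_call_K0.
apply/cvgrPdist_le => e e0.
have /cvgrPdist_le/(_ e e0) [y [_ Hy]] := @cvg_normal_cdfy R.
(* The limit only controls arguments strictly beyond [y], hence the shift by 1. *)
have {}Hy : 1 - e <= N (y + 1).
  have := Hy (y + 1); rewrite ltrDl => /(_ ltr01) /ler_normlP [_].
  by rewrite lerBlDr addrC -lerBlDr.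
near=> h.
have h0 : 0 < h by near: h; exact: nbhs_right_gt.
have hle : h <= S * expR (- V * (y + 1 + V / 2)).
  by near: h; apply: nbhs_right_le; rewrite mulr_gt0 ?expR_gt0.
have [_ lo] := bs_call_ge S0 (ltW h0) V0.
have up := bs_call_le_small_strike S0 V0 h0 hle.
rewrite add0r; set b := bs_call _ _ _ in lo up *.
have hn : h != 0 by rewrite gt_eqF.
have -> : - 1 - h^-1 * (b - S) = - (h^-1 * (b - (S - h))) by field.
rewrite normrN ger0_norm; last by rewrite mulr_ge0 ?invr_ge0 ?subr_ge0// ltW.
rewrite mulrC ler_pdivrMr// lerBlDr (le_trans up)//.
have := ler_wpM2l (ltW h0) Hy; lra.
Unshelve. all: by end_near. Qed.

Lemma bs_call_cvgy (S V : R) : 0 < S -> 0 <= V ->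
  bs_call S K V @[K --> +oo] --> (0 : R).
Proof.
move=> S0 V0; apply/cvgrPdist_le => e e0.
have eS0 : 0 < e / S by rewrite divr_gt0.
have /cvgrPdist_le/(_ _ eS0) [y [_ Hy]] := @cvg_normal_cdfNy R.
have {}Hy : N (y - 1) <= e / S.
  have := Hy (y - 1); rewrite gtrBl => /(_ ltr01).
  by rewrite sub0r normrN ger0_norm ?normal_cdf_ge0.
near=> K.
have K0 : 0 < K by near: K; exact: nbhs_pinfty_gt.
have Kge : S * expR (- V * (y - 1 - V / 2)) <= K.
  by near: K; apply: nbhs_pinfty_ge; rewrite num_real.
have [lo _] := bs_call_ge S0 (ltW K0) V0.
rewrite sub0r normrN ger0_norm//.
apply: (le_trans (bs_call_le_large_strike S0 V0 K0 Kge)).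
by rewrite mulrC -ler_pdivlMr.
Unshelve. all: by end_near. Qed.

Lemma diff_n_bs_call (S V : R) n : 0 < S -> 0 < V ->
  diff_n [set K : R | 0 < K] n (fun K => bs_call S K V).
Proof.
move=> S0 V0.
pose d K : R := ln (S / K) / V - V / 2.
have dn : diff_n [set K : R | 0 < K] n d.
  apply: (@diff_nD _ _ _ (fun K => ln (S / K) / V) (cst (- (V / 2))));
    last exact: diff_n_cst.
  apply: (@diff_nM _ _ _ (@ln R \o (fun K => S / K)) (cst V^-1)); last exact: diff_n_cst.
  apply: diff_n_comp; last 2 first.
  - exact: diff_n_ln.
  - by apply: (@diff_nM _ _ _ (cst S)); [exact: diff_n_cst | exact: diff_n_inv].
  by move=> K K0 /=; rewrite divr_gt0.
have Nn u : diff_n [set K : R | 0 < K] n u -> diff_n [set K : R | 0 < K] n (N \o u).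
  by move=> un; apply: (@diff_n_comp _ _ setT) => //; exact: diff_n_normal_cdf.
apply: (@diff_n_eq _ _ _ (cst S \* (N \o (d \+ cst V)) \+ \- (id \* (N \o d)))).
- exact: open_gt.
- by move=> K K0; rewrite bs_call_d ?gt_eqF.
apply: diff_nD; last by apply/diff_nN/diff_nM; [exact: diff_n_id | exact: Nn].
apply: diff_nM; first exact: diff_n_cst.
by apply/Nn/diff_nD => //; exact: diff_n_cst.
Qed.

End BlackScholes.

(** * Inverses and interpolation *)

Section InverseNonneg.
Context {R : realType} {n : nat}.
Variable A : 'M[R]_n.
Hypothesis A_offdiag : forall i k, i != k -> A i k <= 0.
Hypothesis A_colsum : forall k, \sum_i A i k = 1.

(* At a column [k] where [u] is minimal, [(u A)_k <= u_k]. *)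
Lemma mulmx_row_ge0 (u : 'rV[R]_n) : (forall k, 0 <= (u *m A) 0 k) ->
  forall i, 0 <= u 0 i.
Proof.
move=> uA i; have [k _ kmin] := @arg_minP _ _ _ i xpredT (fun k => u 0 k) isT.
apply: le_trans (kmin i isT); apply: le_trans (uA k) _.
rewrite mxE -[leRHS]mulr1 -(A_colsum k) mulr_sumr; apply: ler_sum => l _.
have [->//|lk] := eqVneq l k.
by apply: ler_wnM2r; [exact: A_offdiag | exact: kmin].
Qed.

(** For [u] in the left kernel, the minimum principle applies to both [u] and [- u], so [u = 0]. *)
Lemma colsum1_unitmx : A \in unitmx.
Proof.
rewrite -row_free_unit -kermx_eq0; apply/eqP/row_matrixP => i; rewrite row0.
have uA0 : row i (kermx A) *m A = 0 by rewrite -row_mul mulmx_ker row0.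
apply/rowP => k; rewrite [in RHS]mxE; apply/eqP; rewrite eq_le; apply/andP; split.
  have : forall l, 0 <= ((- row i (kermx A)) *m A) 0 l.
    by move=> l; rewrite mulNmx uA0 oppr0 mxE.
  by move/mulmx_row_ge0/(_ k); rewrite mxE oppr_ge0.
have : forall l, 0 <= (row i (kermx A) *m A) 0 l by move=> l; rewrite uA0 mxE.
by move/mulmx_row_ge0/(_ k).
Qed.

(** Each row of the inverse times [A] is a row of the identity, which is nonnegative. *)
Lemma colsum1_invmx_ge0 i k : 0 <= invmx A i k.
Proof.
have : forall l, 0 <= (row i (invmx A) *m A) 0 l.
  by move=> l; rewrite -row_mul mulVmx ?colsum1_unitmx// !mxE; case: eqP.
by move/mulmx_row_ge0/(_ k); rewrite mxE.
Qed.

End InverseNonneg.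

(** * Splitting a spot between neighbouring strikes *)

Section HatFunctions.
Context {R : realType}.
Implicit Types (f K : nat -> R) (x : R).

(* Slope on [[K (i - 1), K i]] of [k |-> (x - k)^+], for [0 < i < n]; the slope
   is set to its value left of [x] for [i = 0] and right of [x] for [i = n]. *)
Definition payoff_slope K (n : nat) x (i : nat) : R :=
  if i == 0%N then -1 else if i == n then 0
  else (pospart (x - K i) - pospart (x - K i.-1)) / (K i - K i.-1).

Lemma pospart_ge0_id x : 0 <= x -> pospart x = x.
Proof. by move=> x0; rewrite /pospart max_l. Qed.

Lemma pospart_le0 x : x <= 0 -> pospart x = 0.
Proof. by move=> x0; rewrite /pospart max_r. Qed.

Lemma bracket K n x : K 0%N <= x -> x <= K n.+1 ->
  exists2 p, (p <= n)%N & K p <= x <= K p.+1.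
Proof.
move=> K0; elim: n => [|n IH] xn; first by exists 0%N; rewrite ?K0.
have [/IH[p pn Hp]|/ltW Kx] := leP x (K n.+1); last by exists n.+1; rewrite ?Kx.
by exists p => //; rewrite ltnW.
Qed.

(** With [x] in [[K p, K p.+1]] and [a] its relative position there, the slopes are [-1] up to index
    [p], then [- a] at [p.+1], then 0. Their increments are the hat-function weights of [x]. *)
Lemma payoff_slopeD K n x :
  {in [pred i | (i <= n.+1)%N] &, {homo K : i j / (i < j)%N >-> i < j}} ->
  K 0%N <= x -> x <= K n.+1 ->
  exists p, exists a, [/\ (p <= n)%N, 0 <= a <= 1, x = (1 - a) * K p + a * K p.+1
   & forall i, (i < n.+2)%N ->
     payoff_slope K n.+2 x i.+1 - payoff_slope K n.+2 x i =
     (i == p)%:R * (1 - a) + (i == p.+1)%:R * a].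
Proof.
move=> Kinc K0 Kn; have [p pn /andP[Kp Kp1]] := bracket K0 Kn.
have Kle i j : (i <= j <= n.+1)%N -> K i <= K j.
  move=> /andP[+ jn]; rewrite leq_eqVlt => /predU1P[->//|ij].
  by apply/ltW/Kinc; rewrite ?inE// ltnW// (leq_trans ij).
have KK : 0 < K p.+1 - K p by rewrite subr_gt0 Kinc ?inE// leqW.
pose a := (x - K p) / (K p.+1 - K p).
have KKn : K p.+1 - K p != 0 by rewrite gt_eqF.
have sE i : (i <= n.+2)%N -> payoff_slope K n.+2 x i =
    if (i <= p)%N then -1 else if i == p.+1 then - a else 0.
  move=> iN; rewrite /payoff_slope.
  case: i iN => [//|i iN] /=; rewrite !eqSS.
  case: (ltngtP i p) => [ip|pi|->].
  - rewrite ltn_eqF; last by rewrite (leq_trans ip) ?leqW.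
    have Kx : K i.+1 <= x by apply: le_trans Kp; rewrite Kle// ip leqW.
    have Ki : K i < K i.+1 by rewrite Kinc ?inE//; rewrite ?ltnS (leq_trans _ pn)// ltnW.
    rewrite !pospart_ge0_id ?subr_ge0 ?(le_trans (ltW Ki))//.
    by field; rewrite gt_eqF// subr_gt0.
  - case: eqP => // /eqP ine.
    have iN' : (i.+1 <= n.+1)%N by rewrite ltn_neqAle ine -ltnS.
    rewrite !pospart_le0 ?subrr ?mul0r// subr_le0 (le_trans Kp1)// Kle//.
    + by rewrite pi ltnW.
    + by rewrite leqW// iN'.
  - rewrite ltn_eqF// pospart_le0 ?subr_le0// pospart_ge0_id ?subr_ge0//.
    by rewrite sub0r mulNr.
exists p, a; split=> //.
- apply/andP; split; first by rewrite divr_ge0 ?(ltW KK)// subr_ge0.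
  by rewrite ler_pdivrMr// mul1r lerB.
- by rewrite /a; field.
move=> i iN; rewrite !sE//; last exact: ltnW.
rewrite eqSS; case: (ltngtP i p) => [ip|pi|ip].
- have -> : (i == p.+1) = false by rewrite ltn_eqF// leqW.
  by rewrite !mul0r addr0 subrr.
- by case: eqP => _; rewrite mul0r !add0r ?opprK ?mul1r// oppr0 mul0r.
- have -> : (i == p.+1) = false by rewrite ip ltn_eqF.
  by rewrite mul1r mul0r addr0 opprK addrC.
Qed.

End HatFunctions.

(** * Volatilities and strikes *)

Section Marginals.
Context {R : realType} {nh M N : nat} (D : sanos_data R nh M N) (h : 'rV[R]_nh).
Local Notation That := (expiry D).
Local Notation strike := (strike D h).
Local Notation vol := (vol D h).
Local Notation weight := (weight D h).

(** Monotonicity is limited to indices up to [n], since the sequences in the data are unconstrained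
    beyond their last meaningful index. *)
Lemma homo_lt_upto n (f : nat -> R) :
  (forall i, (i < n)%N -> f i < f i.+1) ->
  {in [pred i | (i <= n)%N] &, {homo f : i j / (i < j)%N >-> i < j}}.
Proof.
move=> fS; apply: homo_ltn_in; first exact: lt_trans.
  by move=> i j; rewrite !inE => _ jn k /andP[_ /ltnW/leq_trans]; apply.
by move=> i; rewrite !inE => _; exact: fS.
Qed.

Lemma homo_le_upto n (f : nat -> R) :
  (forall i, (i < n)%N -> f i <= f i.+1) ->
  {in [pred i | (i <= n)%N] &, {homo f : i j / (i <= j)%N >-> i <= j}}.
Proof.
move=> fS; apply: homo_leq_in; [exact: lexx | exact: le_trans | | ].
  by move=> i j; rewrite !inE => _ jn k /andP[_ /ltnW/leq_trans]; apply.
by move=> i; rewrite !inE => _; exact: fS.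
Qed.

Lemma expiry_ge0 j : (j <= M)%N -> 0 <= That j.
Proof.
move=> jM; rewrite -(expiry0 D).
apply: (@homo_le_upto M) => //; rewrite ?inE// => i iM.
by rewrite ltW// expiry_incr.
Qed.

Lemma sigmoid_gt0 (y : R) : 0 < sigmoid y.
Proof. by rewrite /sigmoid divr_gt0// addr_gt0// expR_gt0. Qed.

Lemma sigma_gt0 j : 0 < sigma D h j.
Proof.
have /andP[s0 s1] := sigma_bounds D; rewrite /sigma ltr_wpDl//.
  by rewrite mulr_ge0 ?sqrtr_ge0 ?ltW.
by rewrite mulr_gt0 ?sigmoid_gt0 ?subr_gt0.
Qed.

Lemma Sigma_gt0 j i : 0 < Sigma D h j i.
Proof.
have /andP[s0 s1] := Sigma_bounds D; rewrite /Sigma addr_gt0//.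
by rewrite mulr_gt0 ?sigmoid_gt0 ?subr_gt0.
Qed.

Lemma vol0 : vol 0 = 0.
Proof. by rewrite /Defs.vol big_geq. Qed.

Lemma vol_lt j : (j < M)%N -> vol j < vol j.+1.
Proof.
move=> jM; rewrite /Defs.vol [ltRHS]big_nat_recr//= ltrDl.
by rewrite mulr_gt0 ?sigma_gt0// subr_gt0 ltr_sqrt ?expiry_incr//
  (le_lt_trans (expiry_ge0 (ltnW jM)))// expiry_incr.
Qed.

Lemma vol_gt0 j : (1 <= j <= M)%N -> 0 < vol j.
Proof.
move=> /andP[j1 jM]; rewrite -vol0.
by apply: (homo_lt_upto vol_lt); rewrite ?inE.
Qed.

Lemma vol_ge0 j : (j <= M)%N -> 0 <= vol j.
Proof. by case: j => [|j] jM; rewrite ?vol0// ltW// vol_gt0. Qed.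

Lemma strike_gt0 j i : 0 < strike j i.
Proof.
rewrite /Defs.strike; case: ifP => // _.
case: ifP => _; first by rewrite mulr_gt0 ?expR_gt0// divr_gt0.
by case: ifP => _; rewrite ?mulr_gt0 ?expR_gt0// divr_gt0.
Qed.

Lemma zstrike_sign : [/\ (0 < N)%N, zstrike D 1 <= 0 & 0 <= zstrike D N].
Proof.
have [i /andP[i1 iN] zi] := zstrike_has0 D.
have zle : {in [pred a | (1 <= a <= N)%N] &,
    {homo zstrike D : a b / (a <= b)%N >-> a <= b}}.
  apply: homo_leq_in; [exact: lexx | exact: le_trans | | ].
    move=> a b; rewrite !inE => /andP[a1 _] /andP[_ bN] k /andP[ak kb].
    by rewrite inE (leq_trans a1 (ltnW ak)) (leq_trans (ltnW kb)).
  move=> a; rewrite !inE => /andP[a1 _] /andP[_ aN].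
  by rewrite ltW// zstrike_incr// a1.
have N0 := leq_trans i1 iN.
by split=> //; rewrite -zi; apply: zle; rewrite ?inE ?i1 ?iN ?N0 /=.
Qed.

Lemma strike_lt j i : (1 <= j <= M)%N -> (i <= N)%N -> strike j i < strike j i.+1.
Proof.
move=> jM iN; have v0 := vol_gt0 jM; have [N0 _ _] := zstrike_sign.
have jn0 : (j == 0%N) = false by case: j jM {v0}.
rewrite /Defs.strike jn0 /= eqSS.
have [->|i0] := eqVneq i 0%N.
  rewrite ltn_eqF//; set e := expR _; have e0 : 0 < e by exact: expR_gt0.
  lra.
rewrite (ltn_eqF (iN : (i < N.+1)%N)).
have [->|iN'] := eqVneq i N.
  set e := expR _; have e0 : 0 < e by exact: expR_gt0.
  lra.
by rewrite ltr_expR ltr_pM2r// zstrike_incr// lt0n i0 ltn_neqAle iN'.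
Qed.

Lemma strike_homo j : (1 <= j <= M)%N ->
  {in [pred i | (i <= N.+1)%N] &, {homo strike j : i k / (i < k)%N >-> i < k}}.
Proof. by move=> jM; apply: homo_lt_upto => i; exact: strike_lt. Qed.

Lemma strike_range j i : (j < M)%N -> (i < @natoms N j)%N ->
  strike j.+1 0 <= strike j i <= strike j.+1 N.+1.
Proof.
move=> jM iN; have [N0 z1 zN] := zstrike_sign.
have half : forall (z v : R), z <= 0 -> 0 <= v -> expR (z * v) <= 1.
  by move=> z v z0 v0; rewrite -expR0 ler_expR mulr_le0_ge0.
have [j0|j0] := eqVneq j 0%N.
  have v0 := vol_ge0 jM.
  rewrite j0 in v0 *; rewrite /Defs.strike /= eqxx.
  have e1 := half _ _ z1 v0.
  have eN : 1 <= expR (zstrike D N * vol 1) by rewrite -expR0 ler_expR mulr_ge0.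
  by apply/andP; split; lra.
have jM' : (1 <= j <= M)%N by rewrite lt0n j0 ltnW.
have lej : {in [pred i | (i <= N.+1)%N] &,
    {homo strike j : i k / (i <= k)%N >-> i <= k}}.
  by apply: homo_le_upto => k kN; rewrite ltW// strike_lt.
have iN1 : (i <= N.+1)%N by case: (j) j0 iN.
have vv := ltW (vol_lt jM).
apply/andP; split.
  apply: (@le_trans _ _ (strike j 0)); last by apply: lej; rewrite ?inE.
  rewrite /Defs.strike (negbTE j0) /= ler_pM2l ?divr_gt0// ler_expR.
  exact: ler_wnM2l.
apply: (@le_trans _ _ (strike j N.+1)); first by apply: lej; rewrite ?inE.
rewrite /Defs.strike (negbTE j0) /= eqxx ler_pM2l ?divr_gt0// ler_expR.
exact: ler_wpM2l.
Qed.

End Marginals.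

(** * Convex order of the marginals *)

Section ConvexOrder.
Context {R : realType} {nh M N : nat} (D : sanos_data R nh M N) (h : 'rV[R]_nh).
Local Notation That := (expiry D).
Local Notation strike := (strike D h).
Local Notation weight := (weight D h).
Local Notation Xi := (Xi D h).
Local Notation xi_plus := (xi_plus D h).
Local Notation xi_minus := (xi_minus D h).
Implicit Types (f : R -> R) (g : nat -> R).

(** Clearing denominators allows coinciding points and makes the case of affine functions linear
    arithmetic. *)
Definition convex_pos f := forall a b c, 0 < a -> a <= b -> b <= c ->
  (c - a) * f b <= (c - b) * f a + (b - a) * f c.

Definition marginal_mean j f : R := \sum_(i < natoms j) weight j i 0 * f (strike j i).

Lemma sum_indic n m g :
  \sum_(i < n) (i == m :> nat)%:R * g i = if (m < n)%N then g m else 0.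
Proof.
case: ltnP => mn.
  rewrite (bigD1 (Ordinal mn))//= eqxx mul1r big1 ?addr0// => i im.
  by rewrite (_ : (i == m :> nat) = false) ?mul0r//; apply/negbTE.
by rewrite big1// => i _; rewrite ltn_eqF ?mul0r// (leq_trans _ mn).
Qed.

Lemma XiE j (i k : 'I_N.+2) : Xi j i k =
  (i == k :> nat)%:R * (1 + xi_plus j k + xi_minus j k)
  - (i == k.+1 :> nat)%:R * xi_plus j k - (i.+1 == k :> nat)%:R * xi_minus j k.
Proof.
rewrite mxE [k == i :> nat]eq_sym [k == i.+1 :> nat]eq_sym [k.+1 == i :> nat]eq_sym.
have [->|ik] := eqVneq (i : nat) k.
  by rewrite ltn_eqF// gtn_eqF// mul1r !mul0r !subr0.
have [<-|ik1] := eqVneq i.+1 (k : nat).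
  have -> : (i == i.+2 :> nat) = false by rewrite ltn_eqF.
  by rewrite !mul0r mul1r subr0 add0r.
have [->|_] := eqVneq (i : nat) k.+1; first by rewrite !mul0r mul1r add0r subr0.
by rewrite !mul0r !subr0.
Qed.

Lemma xi_plus_out j k : ~~ (1 <= k <= N)%N -> xi_plus j k = 0.
Proof. by rewrite /Defs.xi_plus => /negbTE ->. Qed.

Lemma xi_minus_out j k : ~~ (1 <= k <= N)%N -> xi_minus j k = 0.
Proof. by rewrite /Defs.xi_minus => /negbTE ->. Qed.

(** Column [k] only involves the coefficients [xi] at [k], so the sum is a three-point difference.
    At [k = 0] and [k = N.+1] a neighbour is missing, but the coefficients vanish there. *)
Lemma sum_Xi g (j : nat) (k : 'I_N.+2) : \sum_(i < N.+2) g i * Xi j i k =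
  g k + xi_plus j k * (g k - g k.+1) + xi_minus j k * (g k - g k.-1).
Proof.
have -> : \sum_(i < N.+2) g i * Xi j i k =
    \sum_(i < N.+2) (i == k :> nat)%:R * (g i * (1 + xi_plus j k + xi_minus j k))
    - \sum_(i < N.+2) (i == k.+1 :> nat)%:R * (g i * xi_plus j k)
    - \sum_(i < N.+2) (i.+1 == k :> nat)%:R * (g i * xi_minus j k).
  rewrite -!sumrB; apply: eq_bigr => i _; rewrite XiE.
  by move: (_ == _)%:R (_ == _)%:R (_ == _)%:R => *; ring.
rewrite (sum_indic _ _ (fun i => g i * _)) (sum_indic _ _ (fun i => g i * _)) ltn_ord.
have -> : (if (k.+1 < N.+2)%N then g k.+1 * xi_plus j k else 0) = g k.+1 * xi_plus j k.
  case: ifP => // kN; rewrite xi_plus_out ?mulr0//.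
  by apply: contraFN kN => /andP[_ kN]; rewrite !ltnS.
have -> : \sum_(i < N.+2) (i.+1 == k :> nat)%:R * (g i * xi_minus j k) =
    g k.-1 * xi_minus j k.
  case: k => -[|k] kN /=; last first.
    under eq_bigr do rewrite eqSS.
    by rewrite (sum_indic _ _ (fun i => g i * _)) ltnW.
  by rewrite xi_minus_out// mulr0 big1// => i _; rewrite mul0r.
ring.
Qed.

Section ConvexStrikes.
Variable j : nat.
Hypothesis jM : (1 <= j <= M)%N.

Lemma dexpiry_ge0 : 0 <= That j - That j.-1.
Proof.
case: j jM => [//|k] /= kM; by rewrite subr_ge0 ltW// expiry_incr.
Qed.

Lemma xi_plus_ge0 k : 0 <= xi_plus j k.
Proof.
rewrite /Defs.xi_plus; case: ifP => // /andP[k1 kN].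
have K1 := strike_lt D h jM kN.
have K2 : strike j k.-1 < strike j k.
  by case: k k1 kN {K1} => // k _ kN; rewrite (strike_lt D h jM)// ltnW.
rewrite mulr_ge0 ?dexpiry_ge0// mulr_ge0 ?(ltW (Sigma_gt0 _ _ _ _))// divr_ge0 ?sqr_ge0//.
by rewrite mulr_ge0 ?subr_ge0 ?(ltW K1) ?(ltW (lt_trans K2 K1)).
Qed.

Lemma xi_minus_ge0 k : 0 <= xi_minus j k.
Proof.
rewrite /Defs.xi_minus; case: ifP => // /andP[k1 kN].
have K1 := strike_lt D h jM kN.
have K2 : strike j k.-1 < strike j k.
  by case: k k1 kN {K1} => // k _ kN; rewrite (strike_lt D h jM)// ltnW.
rewrite mulr_ge0 ?dexpiry_ge0// mulr_ge0 ?(ltW (Sigma_gt0 _ _ _ _))//.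
rewrite -mulrN -invrN -mulrN opprB divr_ge0 ?sqr_ge0//.
by rewrite mulr_ge0 ?subr_ge0 ?(ltW K2) ?(ltW (lt_trans K2 K1)).
Qed.

Lemma Xi_offdiag (i k : 'I_N.+2) : i != k -> Xi j i k <= 0.
Proof.
move=> ik; rewrite XiE (_ : (i == k :> nat) = false); last exact/negbTE.
by rewrite mul0r sub0r subr_le0 (@le_trans _ _ 0)// ?oppr_le0 mulr_ge0//
  ?xi_plus_ge0 ?xi_minus_ge0.
Qed.

Lemma Xi_colsum (k : 'I_N.+2) : \sum_(i < N.+2) Xi j i k = 1.
Proof.
have := sum_Xi (fun=> 1) j k; rewrite subrr !mulr0 !addr0 => <-.
by apply: eq_bigr => i _; rewrite mul1r.
Qed.

Lemma Xi_unitmx : Xi j \in unitmx.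
Proof. exact: colsum1_unitmx Xi_offdiag Xi_colsum. Qed.

(* [Xi_j^T] acts on [f] as the identity minus a discretized second derivative. *)
Lemma Xi_convex f (k : 'I_N.+2) : convex_pos f ->
  \sum_(i < N.+2) f (strike j i) * Xi j i k <= f (strike j k).
Proof.
move=> cf; rewrite (sum_Xi (fun i => f (strike j i))) -addrA gerDl.
have [kN|kN] := boolP (1 <= k <= N)%N; last first.
  by rewrite xi_plus_out// xi_minus_out// !mul0r addr0.
rewrite /Defs.xi_plus /Defs.xi_minus kN; case/andP: kN => k1 kN.
have K1 := strike_lt D h jM kN.
have K2 : strike j k.-1 < strike j k.
  by case: (nat_of_ord k) k1 kN {K1} => // l _ lN; rewrite (strike_lt D h jM)// ltnW.
have := cf _ _ _ (strike_gt0 D h j k.-1) (ltW K2) (ltW K1).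
have := Sigma_gt0 D h j k; have := dexpiry_ge0.
move: (That j - That j.-1) (Sigma D h j k) => dT S dT0 S0.
move: (f (strike j k.-1)) (f (strike j k)) (f (strike j k.+1)) => fa fb fc.
move: (strike j k.-1) (strike j k) (strike j k.+1) K1 K2 => a b c bc ab cvx.
have [ab0 bc0 ac0] : [/\ 0 < b - a, 0 < c - b & 0 < c - a].
  by rewrite !subr_gt0; split=> //; exact: lt_trans bc.
(* The denominators of the two [xi] terms are such that they add up to a nonnegative multiple of the
   convexity defect. *)
have -> : b ^+ 2 / ((c - a) * (c - b)) * S * dT * (fb - fc) +
    - (b ^+ 2 / ((c - a) * (a - b))) * S * dT * (fb - fa) =
  b ^+ 2 * S * dT / ((c - a) * (c - b) * (b - a)) *
    ((c - a) * fb - ((c - b) * fa + (b - a) * fc)).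
  have abn : a - b != 0 by rewrite -opprB oppr_eq0 gt_eqF.
  by field; rewrite abn !gt_eqF.
apply: mulr_ge0_le0; last by rewrite subr_le0.
have [{}S0 ab1 bc1 ac1] := And4 (ltW S0) (ltW ab0) (ltW bc0) (ltW ac0).
apply: divr_ge0; last by rewrite !mulr_ge0.
by rewrite mulr_ge0// mulr_ge0// sqr_ge0.
Qed.

End ConvexStrikes.

Lemma weightS j : weight j.+1 =
  invmx (Xi j.+1) *m \col_(i < N.+2)
    (call_slope D h j.+1 (strike_prices D h (weight j)) i.+1
     - call_slope D h j.+1 (strike_prices D h (weight j)) i).
Proof. by []. Qed.

(** * One step of the weight recursion *)

Section Step.
Variable j : nat.
Hypothesis jM : (j < M)%N.
Hypothesis w_ge0 : forall i, 0 <= weight j i 0.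
Hypothesis w_mass : marginal_mean j (fun=> 1) = 1.
Hypothesis w_mean : marginal_mean j id = 1.

Local Notation dC := (call_slope D h j.+1 (strike_prices D h (weight j))).
Local Notation slope := (payoff_slope (strike j.+1) N.+2).

(** Slopes of expected payoffs are expected slopes of payoffs; the conventions at both ends match
    those of [payoff_slope]. *)
Lemma call_slopeE i : (i <= N.+2)%N ->
  dC i = \sum_(l < @natoms N j) weight j l 0 * slope (strike j l) i.
Proof.
have jM1 : (1 <= j.+1 <= M)%N by [].
move=> iN; rewrite /call_slope /payoff_slope.
have [i0|i0] := eqVneq i 0%N.
  (* No atom lies below the lowest strike, so the payoff there is linear; unit mass and mean then
     make the first slope [-1]. *)
  have -> : strike_prices D h (weight j) 0 = 1 - strike j.+1 0.
    rewrite -[in RHS]w_mean -[X in _ - X]mul1r -[X in _ - X * _]w_mass.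
    rewrite /marginal_mean mulr_suml -sumrB; apply: eq_bigr => l _.
    rewrite mulr1 -mulrBr pospart_ge0_id// subr_ge0.
    by have /andP[] := strike_range D h jM (ltn_ord l).
  rewrite subr0 addrC addrA addNr add0r mulNr divff ?gt_eqF ?strike_gt0//.
  rewrite -mulr_suml -[in LHS]w_mass /marginal_mean.
  by under eq_bigr do rewrite mulr1; rewrite mulrN1.
have [iN2|iN2] := eqVneq i N.+2; first by rewrite big1// => l _; rewrite mulr0.
rewrite /strike_prices -sumrB mulr_suml; apply: eq_bigr => l _.
by rewrite -mulrBr mulrA.
Qed.

Lemma hat_decomposition (l : 'I_(@natoms N j)) :
  exists p, exists a, [/\ (p <= N)%N, 0 <= a <= 1,
    strike j l = (1 - a) * strike j.+1 p + a * strike j.+1 p.+1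
   & forall i, (i < N.+2)%N ->
     slope (strike j l) i.+1 - slope (strike j l) i =
     (i == p)%:R * (1 - a) + (i == p.+1)%:R * a].
Proof.
have /andP[lo up] := strike_range D h jM (ltn_ord l).
by apply: payoff_slopeD => //; exact: strike_homo.
Qed.

Lemma interpolated_weight_ge0 i : (i < N.+2)%N -> 0 <= dC i.+1 - dC i.
Proof.
move=> iN; rewrite !call_slopeE//; last exact: ltnW.
rewrite -sumrB; apply: sumr_ge0 => l _; rewrite -mulrBr mulr_ge0//.
have [p [a [_ /andP[a0 a1] _ ->//]]] := hat_decomposition l.
by rewrite addr_ge0// mulr_ge0// ?ler0n// subr_ge0.
Qed.

(** Jensen's inequality for the splitting of each atom between its two neighbouring strikes. *)
Lemma le_interpolated f : convex_pos f ->
  marginal_mean j f <= \sum_(i < N.+2) (dC i.+1 - dC i) * f (strike j.+1 i).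
Proof.
have jM1 : (1 <= j.+1 <= M)%N by [].
move=> cf.
have -> : \sum_(i < N.+2) (dC i.+1 - dC i) * f (strike j.+1 i) =
    \sum_(l < @natoms N j) weight j l 0 * \sum_(i < N.+2)
      (slope (strike j l) i.+1 - slope (strike j l) i) * f (strike j.+1 i).
  under [RHS]eq_bigr do rewrite mulr_sumr.
  rewrite exchange_big; apply: eq_bigr => i _.
  rewrite !call_slopeE//; last exact: ltnW.
  by rewrite -sumrB mulr_suml; apply: eq_bigr => l _; rewrite -mulrBr mulrA.
apply: ler_sum => l _; apply: ler_wpM2l => //.
have [p [a [pN /andP[a0 a1] xE hat]]] := hat_decomposition l.
under eq_bigr => i _ do rewrite hat// mulrDl -!mulrA.
rewrite big_split/= (sum_indic _ p (fun i => (1 - a) * f (strike j.+1 i))).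
rewrite (sum_indic _ p.+1 (fun i => a * f (strike j.+1 i))) !ltnS (leqW pN) pN.
have Klt := strike_lt D h jM1 pN.
have Kd : 0 < strike j.+1 p.+1 - strike j.+1 p by rewrite subr_gt0.
have E1 : strike j l - strike j.+1 p = a * (strike j.+1 p.+1 - strike j.+1 p).
  by rewrite xE; ring.
have E2 : strike j.+1 p.+1 - strike j l = (1 - a) * (strike j.+1 p.+1 - strike j.+1 p).
  by rewrite xE; ring.
have xlo : strike j.+1 p <= strike j l.
  by rewrite -subr_ge0 E1 mulr_ge0// ltW.
have xup : strike j l <= strike j.+1 p.+1.
  by rewrite -subr_ge0 E2 mulr_ge0 ?subr_ge0// ltW.
have := cf _ _ _ (strike_gt0 D h j.+1 p) xlo xup.
(* The convexity inequality is the goal multiplied by the grid gap. *)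
rewrite E1 E2 -(ler_pM2l Kd); congr (_ <= _); ring.
Qed.

Lemma weightS_ge0 i : 0 <= weight j.+1 i 0.
Proof.
have jM1 : (1 <= j.+1 <= M)%N by [].
rewrite weightS mxE; apply: sumr_ge0 => k _; rewrite mxE mulr_ge0//.
  exact: colsum1_invmx_ge0 (Xi_offdiag jM1) (Xi_colsum _) _ _.
exact: interpolated_weight_ge0.
Qed.

(** The interpolated weights are [Xi j.+1 *m weight j.+1]. Moving [Xi] onto [f] and applying
    [Xi_convex] under the nonnegative new weights gives the second inequality. *)
Lemma mean_leS f : convex_pos f -> marginal_mean j f <= marginal_mean j.+1 f.
Proof.
have jM1 : (1 <= j.+1 <= M)%N by [].
move=> cf; apply: le_trans (le_interpolated cf) _.
have dCE (i : 'I_N.+2) : dC i.+1 - dC i = \sum_(k < N.+2) Xi j.+1 i k * weight j.+1 k 0.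
  have /(congr1 (fun A : 'cV_N.+2 => A i 0)) : Xi j.+1 *m weight j.+1 =
      \col_(i < N.+2) (dC i.+1 - dC i).
    by rewrite weightS mulmxA mulmxV ?Xi_unitmx// mul1mx.
  by rewrite !mxE => <-.
under eq_bigr do rewrite dCE mulr_suml.
rewrite exchange_big; apply: ler_sum => k _.
rewrite (le_trans _ (ler_wpM2l (weightS_ge0 k) (Xi_convex jM1 k cf)))//.
by rewrite mulr_sumr le_eqVlt; apply/orP; left; apply/eqP/eq_bigr => i _; ring.
Qed.

End Step.

(** The three properties feed each other through the recursion. Mass and mean persist because the
    convex-order inequality holds for an affine function and for its negative. *)
Lemma weight_inv j : (j <= M)%N ->
  [/\ forall i, 0 <= weight j i 0, marginal_mean j (fun=> 1) = 1
    & marginal_mean j id = 1].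
Proof.
elim: j => [_|j IH jM].
  split; first by move=> i; rewrite mxE ler01.
  - by rewrite /marginal_mean big_ord1 mxE mulr1.
  - by rewrite /marginal_mean big_ord1 mxE mulr1.
have [w0 w1 wm] := IH (ltnW jM).
have le := mean_leS jM w0 w1 wm.
have meanN f : marginal_mean j.+1 (fun x => - f x) = - marginal_mean j.+1 f /\
    marginal_mean j (fun x => - f x) = - marginal_mean j f.
  by split; rewrite /marginal_mean -sumrN; apply: eq_bigr => i _; rewrite mulrN.
have affine f : convex_pos f -> convex_pos (fun x => - f x) ->
    marginal_mean j.+1 f = marginal_mean j f.
  move=> cf cNf; apply/eqP; rewrite eq_le le// andbT.
  by have := le _ cNf; have [-> ->] := meanN f; rewrite lerN2.
split; first exact: weightS_ge0.
- rewrite affine//; move=> a b c *; lra.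
- rewrite affine//; move=> a b c * /=; lra.
Qed.

Lemma mean_homo f : convex_pos f ->
  {in [pred j | (j <= M)%N] &, {homo marginal_mean^~ f : i j / (i <= j)%N >-> i <= j}}.
Proof.
move=> cf; apply: homo_le_upto => j jM.
by have [] := weight_inv (ltnW jM) => w0 w1 wm; exact: mean_leS.
Qed.

End ConvexOrder.

(** * The call price surface *)

Lemma convex_function_ge0 {R : realType} (f : R -> R) :
  (forall t x y, 0 <= t <= 1 -> 0 <= x -> 0 <= y ->
    f (t * x + (1 - t) * y) <= t * f x + (1 - t) * f y) ->
  convex_function (`[0, +oo[%classic : set R) f.
Proof.
move=> fconv t x y; rewrite !inE/= !in_itv/= !andbT => x0 y0.
by apply: (fconv t%:num x y _ x0 y0); apply/andP; split.
Qed.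

(** * Finite mixtures of Black-Scholes prices, as lists of (weight, spot) pairs *)

Section CallMixture.
Context {R : realType}.
Variables (s : seq (R * R)) (V : R).
Hypothesis V_ge0 : 0 <= V.
Hypothesis w_ge0 : forall p, p \in s -> 0 <= p.1.
Hypothesis spot_gt0 : forall p, p \in s -> 0 < p.2.
Hypothesis w_mass : \sum_(p <- s) p.1 = 1.
Hypothesis w_mean : \sum_(p <- s) p.1 * p.2 = 1.

Let F (K : R) : R := \sum_(p <- s) p.1 * bs_call p.2 K V.

Lemma mixture_ge0 K : 0 <= K -> 0 <= F K.
Proof.
move=> K0; rewrite /F big_seq; apply: sumr_ge0 => p ps.
by rewrite mulr_ge0 ?w_ge0//; have [] := bs_call_ge (spot_gt0 ps) K0 V_ge0.
Qed.

Lemma mixture_convex t x y : 0 <= t <= 1 -> 0 <= x -> 0 <= y ->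
  F (t * x + (1 - t) * y) <= t * F x + (1 - t) * F y.
Proof.
move=> t01 x0 y0; rewrite /F !mulr_sumr -big_split/= !big_seq.
apply: ler_sum => p ps; rewrite !(mulrCA _ p.1) -mulrDr ler_wpM2l ?w_ge0//.
exact: bs_call_strike_convex (spot_gt0 ps) V_ge0 t01 x0 y0.
Qed.

Lemma mixture_K0 : F 0 = 1.
Proof. by rewrite /F -w_mean; apply: eq_bigr => p _; rewrite bs_call_K0. Qed.

Lemma mixture_cvgy : F K @[K --> +oo] --> (0 : R).
Proof.
have -> : (0 : R) = \sum_(p <- s) 0 by rewrite big1.
rewrite /F; elim: s spot_gt0 => [|p r IH] r0.
  under eq_fun do rewrite big_nil; rewrite big_nil; exact: cvg_cst.
under eq_fun do rewrite big_cons; rewrite big_cons.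
apply: cvgD; last by apply: IH => q qr; apply: r0; rewrite inE qr orbT.
rewrite -[X in _ --> X](mulr0 p.1); apply: cvgMr; apply: bs_call_cvgy => //.
by apply: r0; rewrite inE eqxx.
Qed.

Lemma mixture_slope0 : right_derivative F 0 (-1).
Proof.
rewrite /right_derivative.
have -> : (fun k => k^-1 * (F (0 + k) - F 0)) = (fun k => \sum_(p <- s)
    p.1 * (k^-1 * (bs_call p.2 (0 + k) V - bs_call p.2 0 V))).
  apply/funext => k; rewrite /F -sumrB mulr_sumr; apply: eq_bigr => p _.
  by rewrite mulrCA -mulrBr.
(* Unit mass lets the limit be written as a sum over [s], ready for a termwise induction. *)
have -> : (-1 : R) = \sum_(p <- s) p.1 * -1.
  by rewrite -mulr_suml w_mass mul1r.
elim: s spot_gt0 => [|p r IH] r0.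
  under eq_fun do rewrite big_nil; rewrite big_nil; exact: cvg_cst.
under eq_fun do rewrite big_cons; rewrite big_cons.
apply: cvgD; last by apply: IH => q qr; apply: r0; rewrite inE qr orbT.
apply: cvgMr; apply: bs_call_slope0 => //.
by apply: r0; rewrite inE eqxx.
Qed.

Lemma diff_n_mixture n : 0 < V -> diff_n [set K | 0 < K] n F.
Proof.
(* [diff_n_sum] needs every summand to be regular, but spots are positive only for members of [s];
   indexing by position secures membership. *)
move=> V0; have -> : F = (fun K => \sum_(i < size s)
    (tnth (in_tuple s) i).1 * bs_call (tnth (in_tuple s) i).2 K V).
  by apply/funext => K; rewrite /F big_tnth.
apply: diff_n_sum => i.
apply: (@diff_nM _ _ _ (cst _)); first exact: diff_n_cst.
by apply: diff_n_bs_call => //; apply: spot_gt0; exact: mem_tnth.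
Qed.

End CallMixture.

(** * Interpolation between expiries *)

Section Interpolation.
Context {R : realType} {nh M N : nat} (D : sanos_data R nh M N).
Local Notation That := (expiry D).
Local Notation alpha := (alpha D).
Local Notation segment := (segment D).

Definition interp (e : nat -> R) (T : R) : R :=
  if That M < T then e M
  else alpha T * e (segment T) + (1 - alpha T) * e (segment T).-1.

Lemma segmentP T : T <= That M ->
  [/\ (segment T <= M)%N, T <= That (segment T)
   & forall i, (i < segment T)%N -> That i < T].
Proof.
move=> TM; have hasT : has (fun j => T <= That j) (iota 0 M.+1).
  by apply/hasP; exists M; rewrite ?mem_iota// add0n leqnn.
have sM : (segment T < M.+1)%N by rewrite -[X in (_ < X)%N](size_iota 0) -has_find.
split=> //; first by have := nth_find 0%N hasT; rewrite nth_iota.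
move=> i iT; have := before_find 0%N iT.
by rewrite nth_iota ?(ltn_trans iT)// ltNge => ->.
Qed.

Lemma expiry_lt i j : (i < j)%N -> (j <= M)%N -> That i < That j.
Proof.
move=> ij jM; apply: (homo_lt_upto (@expiry_incr _ _ _ _ D)); rewrite ?inE//.
by rewrite ltnW// (leq_trans ij).
Qed.

Lemma expiryM_gt0 : 0 < That M.
Proof. by rewrite -[ltLHS](expiry0 D) expiry_lt// (expiries_pos D). Qed.

Lemma segment0 : segment 0 = 0%N.
Proof. by rewrite /Defs.segment /= expiry0 lexx. Qed.

(* The denominator vanishes here: [segment 0 = 0] and [0 / 0 = 0]. *)
Lemma alpha0 : alpha 0 = 0.
Proof. by rewrite /Defs.alpha segment0 /= subrr invr0 mulr0. Qed.

Lemma segment_gt0 T : 0 < T -> T <= That M -> (0 < segment T)%N.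
Proof.
move=> T0 /segmentP[_ + _]; case: (segment T) => //.
by rewrite expiry0 leNgt T0.
Qed.

Lemma alpha_gt0 T : 0 < T -> T <= That M -> 0 < alpha T.
Proof.
move=> T0 TM; have j0 := segment_gt0 T0 TM; have [jM Tj iT] := segmentP TM.
have iT' : That (segment T).-1 < T by apply: iT; rewrite prednK.
by rewrite /Defs.alpha divr_gt0 ?subr_gt0// (lt_le_trans iT').
Qed.

Lemma alpha_le1 T : 0 < T -> T <= That M -> alpha T <= 1.
Proof.
move=> T0 TM; have j0 := segment_gt0 T0 TM; have [jM Tj iT] := segmentP TM.
have iT' : That (segment T).-1 < T by apply: iT; rewrite prednK.
by rewrite /Defs.alpha ler_pdivrMr ?mul1r ?lerB// subr_gt0 (lt_le_trans iT').
Qed.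

Lemma alpha01 T : 0 <= T -> T <= That M -> 0 <= alpha T <= 1.
Proof.
move=> T0 TM; have [->|Tn0] := eqVneq T 0; first by rewrite alpha0 lexx ler01.
have {}T0 : 0 < T by rewrite lt0r Tn0.
by rewrite ltW ?alpha_gt0 ?alpha_le1.
Qed.

(** The coefficients depend on [T] alone and serve every [e]; beyond the last expiry [a = 1]. *)
Lemma interpP T : 0 <= T -> exists a, exists j, exists k,
  [/\ 0 <= a <= 1, (j <= M)%N, (k <= M)%N
   & forall e, interp e T = a * e j + (1 - a) * e k].
Proof.
move=> T0; rewrite /interp; have [TM|TM] := ltP (That M) T.
  exists 1, M, M; split; rewrite ?ler01 ?lexx// => e.
  by rewrite mul1r subrr mul0r addr0.
have [jM _ _] := segmentP TM.
exists (alpha T), (segment T), (segment T).-1; split=> //; first exact: alpha01.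
exact: leq_trans (leq_pred _) jM.
Qed.

Lemma interp_le e e' T : 0 <= T -> (forall j, (j <= M)%N -> e j <= e' j) ->
  interp e T <= interp e' T.
Proof.
move=> T0 ee'; have [a [j [k [/andP[a0 a1] jM kM E]]]] := interpP T0.
by rewrite !E lerD// ler_wpM2l ?ee'// subr_ge0.
Qed.

Section Monotone.
Variable e : nat -> R.
Hypothesis e_homo :
  {in [pred j | (j <= M)%N] &, {homo e : i j / (i <= j)%N >-> i <= j}}.

Lemma interp_bounds T : 0 <= T -> T <= That M ->
  e (segment T).-1 <= interp e T <= e (segment T).
Proof.
move=> T0 TM; have [jM _ _] := segmentP TM; have /andP[a0 a1] := alpha01 T0 TM.
rewrite /interp ltNge TM /=.
have : e (segment T).-1 <= e (segment T).
  by apply: e_homo; rewrite ?inE ?leq_pred// (leq_trans (leq_pred _)).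
move: (alpha T) (e _) (e _) a0 a1 => a x y a0 a1 xy.
have := ler_wpM2l a0 xy; have a1' : 0 <= 1 - a by rewrite subr_ge0.
by have := ler_wpM2l a1' xy; move=> *; apply/andP; split; lra.
Qed.

(** Across segments, a grid value separates the two sides; within one segment, [alpha] increases. *)
Lemma interp_homo T1 T2 : 0 <= T1 -> T1 <= T2 -> interp e T1 <= interp e T2.
Proof.
move=> T10 T12; have T20 := le_trans T10 T12.
have [T2M|T2M] := ltP (That M) T2.
  rewrite {2}/interp T2M; have [T1M|T1M] := ltP (That M) T1.
    by rewrite /interp T1M.
  have /andP[_ /le_trans] := interp_bounds T10 T1M; apply.
  by have [jM _ _] := segmentP T1M; apply: e_homo; rewrite ?inE.
have T1M := le_trans T12 T2M.
have [j1M T1j _] := segmentP T1M; have [j2M T2j iT2] := segmentP T2M.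
have [j21|j12] := leqP (segment T2) (segment T1); last first.
  have /andP[_ /le_trans] := interp_bounds T10 T1M; apply.
  have /andP[+ _] := interp_bounds T20 T2M; apply: le_trans.
  by apply: e_homo; rewrite ?inE ?(leq_trans (leq_pred _))// -ltnS (ltn_predK j12).
(* A smaller [segment T2] would put its right end strictly below [T1], yet at or above [T2]. *)
have jj : segment T1 = segment T2.
  apply/eqP; rewrite eqn_leq j21 andbT leqNgt; apply/negP => lt21.
  have [_ _ /(_ _ lt21)] := segmentP T1M.
  by apply/negP; rewrite -leNgt (le_trans T12).
rewrite /interp !ltNge T1M T2M /= jj.
have xy : e (segment T2).-1 <= e (segment T2).
  by apply: e_homo; rewrite ?inE ?leq_pred// (leq_trans (leq_pred _)).
have a12 : alpha T1 <= alpha T2.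
  rewrite /Defs.alpha jj ler_wpM2r ?lerB// invr_ge0 subr_ge0.
  by case: (segment T2) j2M => // k kM; rewrite ltW// expiry_incr.
have := ler_wpM2r (_ : 0 <= e (segment T2) - e (segment T2).-1) a12.
rewrite subr_ge0 => /(_ xy); lra.
Qed.

End Monotone.
End Interpolation.

(** * Properties of the decoder *)

Section Surface.
Context {R : realType} {nh M N : nat} (D : sanos_data R nh M N) (h : 'rV[R]_nh).
Local Notation That := (expiry D).
Local Notation vol_at := (vol_at D h).
Local Notation mean := (marginal_mean D h).
Local Notation C := (decoder D h).

Lemma vol_homo : {in [pred j | (j <= M)%N] &,
  {homo vol D h : i j / (i <= j)%N >-> i <= j}}.
Proof. by apply: homo_le_upto => j jM; rewrite ltW// vol_lt. Qed.

Lemma vol_atE T : T <= That M -> vol_at T = interp D (vol D h) T.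
Proof. by move=> TM; rewrite /Defs.vol_at /interp ltNge TM. Qed.

Lemma vol_at0 : vol_at 0 = 0.
Proof.
have TM : ~~ (That M < 0) by rewrite -leNgt ltW// expiryM_gt0.
by rewrite /Defs.vol_at (negbTE TM) alpha0 segment0 /= mul0r add0r subr0 mul1r vol0.
Qed.

Lemma vol_at_gt0 T : 0 < T -> 0 < vol_at T.
Proof.
move=> T0; have M0 := expiries_pos D; have v0 := vol_ge0 D h.
rewrite /Defs.vol_at; have [TM|TM] := ltP (That M) T.
  rewrite mulr_gt0 ?vol_gt0 ?M0 ?leqnn// sqrtr_gt0 divr_gt0//.
  exact: expiryM_gt0.
have j0 := segment_gt0 T0 TM; have [jM _ _] := segmentP TM.
apply: (@lt_le_trans _ _ (alpha D T * vol D h (segment D T))).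
  by rewrite mulr_gt0 ?alpha_gt0 ?vol_gt0 ?j0.
rewrite lerDl mulr_ge0 ?subr_ge0 ?alpha_le1//.
by rewrite v0// (leq_trans (leq_pred _)).
Qed.

Lemma vol_at_homo T1 T2 : 0 <= T1 -> T1 <= T2 -> vol_at T1 <= vol_at T2.
Proof.
move=> T10 T12; have T20 := le_trans T10 T12.
have TM0 := expiryM_gt0 D.
have [T2M|T2M] := ltP (That M) T2; last first.
  rewrite !vol_atE// ?(le_trans T12)//.
  exact (interp_homo D vol_homo T10 T12).
have vM0 : 0 <= vol D h M by exact: vol_ge0.
rewrite [leRHS]/Defs.vol_at T2M; have [T1M|T1M] := ltP (That M) T1.
  rewrite /Defs.vol_at T1M ler_wpM2l// ler_wsqrtr// ler_wpM2r// invr_ge0.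
  exact: ltW.
(* When the last expiry lies between the two times, [vol D h M] separates them. *)
rewrite vol_atE//; have /andP[_ /le_trans] := interp_bounds vol_homo T10 T1M; apply.
apply: (@le_trans _ _ (vol D h M)).
  by have [jM _ _] := segmentP T1M; apply: vol_homo; rewrite ?inE.
rewrite ler_peMr// -[leLHS]sqrtr1 ler_wsqrtr// ler_pdivlMr// mul1r.
exact: ltW.
Qed.

(* By the junk values of [segment 0] and [alpha 0], the interpolation formula
   also holds at [T = 0]. *)
Lemma decoderE T K : 0 <= T -> 0 <= K ->
  C T K = interp D (fun j => mean j (fun S => bs_call S K (mu D * vol_at T))) T.
Proof.
move=> T0 K0; rewrite /decoder /interp; case: eqP => [->|_] //.
have TM : ~~ (That M < 0) by rewrite -leNgt ltW// expiryM_gt0.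
rewrite (negbTE TM) alpha0 segment0 vol_at0 mulr0 mul0r add0r subr0 mul1r.
by rewrite /marginal_mean big_ord1 mxE mul1r bs_call_V0.
Qed.

Lemma mu_vol_ge0 T : 0 <= T -> 0 <= mu D * vol_at T.
Proof.
move=> T0; have /andP[m0 _] := mu_bounds D; rewrite mulr_ge0//.
by rewrite -vol_at0 vol_at_homo.
Qed.

Definition atoms j (c : R) : seq (R * R) :=
  [seq (c * weight D h j i 0, strike D h j i) | i : 'I_(@natoms N j)].

Lemma sum_atoms j c (f : R -> R) :
  \sum_(p <- atoms j c) p.1 * f p.2 = c * mean j f.
Proof.
rewrite big_map big_enum /marginal_mean mulr_sumr.
by apply: eq_bigr => i _; rewrite mulrA.
Qed.

Lemma mem_atoms j c p : (j <= M)%N -> 0 <= c -> p \in atoms j c ->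
  0 <= p.1 /\ 0 < p.2.
Proof.
move=> jM c0 /mapP[i _ ->] /=; have [w0 _ _] := weight_inv D h jM.
by rewrite mulr_ge0// strike_gt0.
Qed.

(** Both marginals are priced at the same volatility, so their scaled atoms concatenate into one
    mixture, chosen independently of [K]. *)
Lemma decoder_mixture T : 0 <= T -> exists s : seq (R * R),
  [/\ forall p, p \in s -> 0 <= p.1, forall p, p \in s -> 0 < p.2,
      \sum_(p <- s) p.1 = 1, \sum_(p <- s) p.1 * p.2 = 1
    & forall K, 0 <= K ->
        C T K = \sum_(p <- s) p.1 * bs_call p.2 K (mu D * vol_at T)].
Proof.
move=> T0; have [a [j [k [/andP[a0 a1] jM kM E]]]] := interpP D T0.
have a1' : 0 <= 1 - a by rewrite subr_ge0.
have sE (f : R -> R) : \sum_(p <- atoms j a ++ atoms k (1 - a)) p.1 * f p.2 =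
    interp D (fun i => mean i f) T.
  by rewrite big_cat/= !sum_atoms E.
have [_ mj1 mjm] := weight_inv D h jM; have [_ mk1 mkm] := weight_inv D h kM.
exists (atoms j a ++ atoms k (1 - a)); split.
- by move=> p; rewrite mem_cat => /orP[] /mem_atoms => [/(_ jM a0)|/(_ kM a1')] [].
- by move=> p; rewrite mem_cat => /orP[] /mem_atoms => [/(_ jM a0)|/(_ kM a1')] [].
- under eq_bigr do rewrite -[_.1]mulr1.
  by rewrite (sE (fun=> 1)) E mj1 mk1 !mulr1 addrC subrK.
- by rewrite (sE id) E mjm mkm !mulr1 addrC subrK.
- by move=> K K0; rewrite decoderE// (sE (fun S => bs_call S K _)).
Qed.

Lemma decoder_calendar K T1 T2 : 0 <= K -> 0 <= T1 -> T1 <= T2 ->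
  C T1 K <= C T2 K.
Proof.
move=> K0 T10 T12; have T20 := le_trans T10 T12.
rewrite (decoderE T10 K0) (decoderE T20 K0).
have V0 := mu_vol_ge0 T10; have V12 : mu D * vol_at T1 <= mu D * vol_at T2.
  by have /andP[m0 _] := mu_bounds D; rewrite ler_wpM2l// vol_at_homo.
move: (mu D * vol_at T1) (mu D * vol_at T2) V0 V12 => V1 V2 V10 V12.
(* First the marginal moves to [T2] at volatility [V1], by convex order; then the volatility rises
   to [V2]. *)
apply: (@le_trans _ _ (interp D (fun j => mean j (fun S => bs_call S K V1)) T2)).
  have cvx : convex_pos (fun S => bs_call S K V1).
    by move=> a b c; exact: bs_call_spot_convex.
  exact (interp_homo D (mean_homo D h cvx) T10 T12).
have := @interp_le _ _ _ _ D (fun j => mean j (fun S => bs_call S K V1))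
  (fun j => mean j (fun S => bs_call S K V2)) T2 T20.
apply => j jM; have [w0 _ _] := weight_inv D h jM.
apply: ler_sum => i _; apply: ler_wpM2l; first exact: w0.
by apply: bs_call_vol_le V10 V12; first exact: strike_gt0.
Qed.

Lemma decoder_is_well_defined : decoder_well_defined D h.
Proof.
split; last by move=> T /ltW; exact: mu_vol_ge0.
by move=> j jM; split;
  [exact: strike_gt0 | move=> i; exact: strike_lt | exact: Xi_unitmx].
Qed.

Lemma decoder_call_price_surface : call_price_surface C.
Proof.
move=> T K T0 K0; have [s [w0 S0 _ _ ->//]] := decoder_mixture T0.
by apply: mixture_ge0 => //; exact: mu_vol_ge0.
Qed.

Lemma decoder_butterfly : no_negative_butterflies C.
Proof.
move=> T T0; have [s [w0 S0 _ _ CE]] := decoder_mixture T0.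
apply: convex_function_ge0 => t x y t01 x0 y0.
have /andP[t0 t1] := t01.
rewrite !CE//; last by rewrite addr_ge0 ?mulr_ge0 ?subr_ge0.
exact: mixture_convex (mu_vol_ge0 T0) w0 S0 _ _ _ t01 x0 y0.
Qed.

Lemma decoder_no_arbitrage : free_of_static_arbitrage C.
Proof.
split.
- exact: decoder_butterfly.
- by move=> K K0 T1 T2; exact: decoder_calendar.
- move=> T T0; have [s [_ _ _ wm ->//]] := decoder_mixture T0.
  exact: mixture_K0.
- by move=> K K0; rewrite /decoder eqxx.
- move=> T T0; have [s [_ S0 _ _ CE]] := decoder_mixture T0.
  apply: cvg_trans (mixture_cvgy (mu_vol_ge0 T0) S0).
  apply: near_eq_cvg; near=> K.
  have K0 : 0 <= K by near: K; apply: nbhs_pinfty_ge; rewrite num_real.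
  by rewrite CE.
- move=> T T0; have [s [_ S0 w1 _ CE]] := decoder_mixture T0.
  exists (-1); last by rewrite lexx ltrN10.
  apply: cvg_trans (mixture_slope0 (mu_vol_ge0 T0) S0 w1).
  apply: near_eq_cvg; near=> k.
  have k0 : 0 <= k by near: k; exact: nbhs_right_ge.
  by rewrite !CE// add0r.
Unshelve. all: by end_near. Qed.

Lemma decoder_smooth : 0 < mu D -> smooth_in_strike C.
Proof.
move=> m0 T T0 n; have [s [_ S0 _ _ CE]] := decoder_mixture (ltW T0).
apply: (@diff_n_derivable _ [set K : R | 0 < K]); first exact: open_gt.
have V0 : 0 < mu D * vol_at T by rewrite mulr_gt0// vol_at_gt0.
(* Order [n.+1] is needed because the [n]-th derivative must itself be derivable. *)
have sn := diff_n_mixture S0 n.+1 V0.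
apply: (@diff_n_eq _ [set K : R | 0 < K] n.+1 _ _ _ _ sn); first exact: open_gt.
by move=> K /= K0; rewrite CE// ltW.
Qed.

End Surface.

(** The decoder results hold for an arbitrary input [h], hence along every realization. *)
Theorem theorem3p1 (R : realType) (nh M N : nat) (D : sanos_data R nh M N)
    (d : measure_display) (Omega : measurableType d) (P : probability Omega R)
    (sh : nat -> {RV P >-> (R * nh.-tuple R)%type})
    (S_integrable : forall t : nat,
      P.-integrable setT (fun w => (expR (sh t w).1)%:E)) :
  forall (t : nat) (w : Omega),
    let S := expR (sh t w).1 in
    let h := row_of_tuple (sh t w).2 in
    let C := decoder D h in
    [/\ 0 < S,
        decoder_well_defined D h /\ call_price_surface C,
        free_of_static_arbitrage C
      & 0 < mu D -> smooth_in_strike C].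
Proof.
move=> t w S h C; split.
- exact: expR_gt0.
- by split; [exact: decoder_is_well_defined | exact: decoder_call_price_surface].
- exact: decoder_no_arbitrage.
- exact: decoder_smooth.
Qed.
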